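(* Consider the dynamical system for $(x,y,\lambda)$ given in the context, with parameters $\varepsilon\in\{+1,-1\}$, $\xi$, $w_m$ and function $z(\lambda)$. Suppose $\varepsilon\xi(1-6\xi)>0$ and that $\lambda_1^*\in I$ satisfies $z(\lambda_1^* )^2=\frac{1}{6\varepsilon\xi(1-6\xi)}$. Then: (i) the point $x_1^*=-6\xi z(\lambda_1^* )$, $y_1^*=0$, $\lambda=\lambda_1^*$ is a critical point of the system, and the eigenvalues of the linearization matrix at it are $6\xi,\ 6\xi,\ 12\xi$; hence it is an unstable node if $\xi>0$, and a stable node if $\xi<0$ (which under the hypothesis is possible only for $\varepsilon=-1$); (ii) it represents a singularity at a finite value of the scale factor. That is, for every trajectory lying in the region $D>0$ that converges to this point as $\tau\to-\infty$ (if $\xi>0$), respectively as $\tau\to+\infty$ (if $\xi<0$), $\ln a$ converges to a finite limit while $|w_{\mathrm{eff}}|\to\infty$ along the trajectory. The singularity is thus a past one for $\varepsilon=+1$, $0<\xi<1/6$ and for $\varepsilon=-1$, $\xi>1/6$, and a future one for $\varepsilon=-1$, $\xi<0$.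
   Context: Let $\varepsilon\in\{+1,-1\}$ ($+1$ canonical, $-1$ phantom scalar field), $\xi,w_m\in\mathbb{R}$, and let $z:I\to\mathbb{R}$ be a smooth function on an open interval $I$ with nowhere vanishing derivative $z'(\lambda)=\frac{dz}{d\lambda}$ (equivalently $z'(\lambda)=-1/(\lambda^2(\Gamma(\lambda)-1))$ for the function $\Gamma=U''U/U'^2$ determined by the scalar field potential $U$). Put $$D=1-6\varepsilon\xi(1-6\xi)z(\lambda)^2,$$ $$B=-\tfrac43-2\xi\lambda y^2z(\lambda)+\varepsilon(1-6\xi)(1-w_m)x^2+2\varepsilon\xi(1-3w_m)(x+z(\lambda))^2+(1+w_m)(1-y^2).$$ The dynamical system on $\mathbb{R}^2\times I$ is $$\frac{dx}{d\tau}=-\left(x-\tfrac{\varepsilon}{2}\lambda y^2\right)D+\tfrac32\left(x+6\xi z(\lambda)\right)B,\qquad \frac{dy}{d\tau}=y\left(2-\tfrac12\lambda x\right)D+\tfrac32\,yB,\qquad \frac{d\lambda}{d\tau}=\frac{x\,D}{z'(\lambda)}.$$ The scale factor $a$ along a trajectory is determined (up to a constant factor) by $\frac{d\ln a}{d\tau}=D$, where the physical region is $D>0$. The effective equation of state parameter is $$w_{\mathrm{eff}}=\frac1D\Big[-1+\varepsilon(1-6\xi)(1-w_m)x^2+2\varepsilon\xi(1-3w_m)(x+z)^2+(1+w_m)(1-y^2)-2\varepsilon\xi(1-6\xi)z^2-2\xi y^2\lambda z\Big],\quad z=z(\lambda).$$ A node is a critical point at which all eigenvalues of the linearization matrix are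 real, nonzero and of the same sign (stable if negative, unstable if positive). *)

(* Defs.v *)
From mathcomp Require Export all_boot all_order all_algebra.
From mathcomp Require Export all_classical all_reals all_analysis.
From mathcomp Require Export complex.
Export Order.TTheory GRing.Theory Num.Theory.
Export numFieldNormedType.Exports.

#[export] Set Implicit Arguments.
#[export] Unset Strict Implicit.
#[export] Unset Printing Implicit Defensive.

Local Open Scope classical_set_scope.
Local Open Scope ring_scope.

Definition open_interval (R : realType) (I : set R) : Prop :=
  open I /\ is_interval I.

(* Only the values of [z] on [I] matter when [I] is open: outside [I] the
   total function [z] is arbitrary. *)
Definition smooth_on (R : realType) (I : set R) (z : R -> R) : Prop :=
  forall (n : nat) (l : R), I l -> derivable (derive1n n z) l 1.

Section VectorFields.
Variables (R : realType) (n : nat).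
Implicit Types (F : 'rV[R]_n.+1 -> 'rV[R]_n.+1) (p : 'rV[R]_n.+1).

Definition critical_point F p : Prop := F p = 0.

(* [jacobian F p] is the linearization matrix acting on row vectors (the
   transpose of the usual one); [eigenvalue] also uses row vectors.  Eigenvalues
   are taken among all complex numbers. *)
Definition linearization_eigenvalue F p (mu : R[i]) : Prop :=
  eigenvalue (map_mx (real_complex R) (jacobian F p)) mu.

(* Differentiability is required since [jacobian] is a total operator. *)
Definition stable_node F p : Prop :=
  [/\ critical_point F p, differentiable F p &
      forall mu, linearization_eigenvalue F p mu ->
        exists2 r : R, mu = real_complex R r & r < 0].

Definition unstable_node F p : Prop :=
  [/\ critical_point F p, differentiable F p &
      forall mu, linearization_eigenvalue F p mu ->
        exists2 r : R, mu = real_complex R r & 0 < r].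

End VectorFields.

Section Cosmology.
Variables (R : realType) (eps xi wm : R) (z : R -> R).

Definition state (x y l : R) : 'rV[R]_3 := \row_i [:: x; y; l]`_i.

Definition Dfun (l : R) : R := 1 - 6 * eps * xi * (1 - 6 * xi) * z l ^+ 2.

Definition Bfun (x y l : R) : R :=
  - (4 / 3) - 2 * xi * l * y ^+ 2 * z l
  + eps * (1 - 6 * xi) * (1 - wm) * x ^+ 2
  + 2 * eps * xi * (1 - 3 * wm) * (x + z l) ^+ 2
  + (1 + wm) * (1 - y ^+ 2).

Definition field_x (x y l : R) : R :=
  - (x - eps / 2 * l * y ^+ 2) * Dfun l
  + 3 / 2 * (x + 6 * xi * z l) * Bfun x y l.

Definition field_y (x y l : R) : R :=
  y * (2 - 1 / 2 * l * x) * Dfun l + 3 / 2 * y * Bfun x y l.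

Definition field_l (x y l : R) : R := x * Dfun l / derive1 z l.

(* The field is meaningful on R^2 x I only, where z' does not vanish. *)
Definition vfield (v : 'rV[R]_3) : 'rV[R]_3 :=
  let x := v 0 0 in let y := v 0 1 in let l := v 0 2 in
  state (field_x x y l) (field_y x y l) (field_l x y l).

Definition weff (v : 'rV[R]_3) : R :=
  let x := v 0 0 in let y := v 0 1 in let l := v 0 2 in
  (Dfun l)^-1 *
  (- 1 + eps * (1 - 6 * xi) * (1 - wm) * x ^+ 2
   + 2 * eps * xi * (1 - 3 * wm) * (x + z l) ^+ 2
   + (1 + wm) * (1 - y ^+ 2)
   - 2 * eps * xi * (1 - 6 * xi) * z l ^+ 2
   - 2 * xi * y ^+ 2 * l * z l).

Variable I : set R.

Definition physical_trajectory (J : set R) (g : R -> 'rV[R]_3) : Prop :=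
  forall t, J t ->
    [/\ I (g t 0 2), 0 < Dfun (g t 0 2) & is_derive t 1 g (vfield (g t))].

Definition scale_factor (J : set R) (g : R -> 'rV[R]_3) (a : R -> R) : Prop :=
  forall t, J t ->
    0 < a t /\ is_derive t 1 (fun s => ln (a s)) (Dfun (g t 0 2)).

(* A trajectory that converges as t -> -oo is defined on some half-line
   ]-oo, T[, and restricting it to a smaller half-line changes no limit. *)
Definition past_singularity (p : 'rV[R]_3) : Prop :=
  forall (T : R) (g : R -> 'rV[R]_3) (a : R -> R),
    physical_trajectory `]-oo, T[ g ->
    scale_factor `]-oo, T[ g a ->
    g t @[t --> -oo] --> p ->
    (exists c : R, ln (a t) @[t --> -oo] --> c) /\
    `|weff (g t)| @[t --> -oo] --> +oo.

Definition future_singularity (p : 'rV[R]_3) : Prop :=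
  forall (T : R) (g : R -> 'rV[R]_3) (a : R -> R),
    physical_trajectory `]T, +oo[ g ->
    scale_factor `]T, +oo[ g a ->
    g t @[t --> +oo] --> p ->
    (exists c : R, ln (a t) @[t --> +oo] --> c) /\
    `|weff (g t)| @[t --> +oo] --> +oo.

End Cosmology.

(* Main.v *)
Require Import Defs.
From mathcomp Require Import ring.

Local Open Scope classical_set_scope.
Local Open Scope ring_scope.

(** Write [K = eps xi (1 - 6 xi)], so that [D = 1 - 6 K z^2].  At the critical
    point [D = 0], [3/2 B = 6 xi], and the linearization is triangular.  Along
    any trajectory [dD/dtau = -12 K z x D], where [-12 K z x] tends to [12 xi]
    at the critical point.  Hence [D] is eventually dominated by a multiple of
    its own derivative, which makes [ln a], a primitive of [D], converge, while
    [w_eff] blows up because its numerator tends to [4 xi <> 0]. *)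

(** * Differentials of maps into row vectors, and derivatives along curves *)

(** The differential is kept as an explicit product, so that [z] and [1 / z'] composed with a
    coordinate can enter the automatic computation of differentials of the field. *)
Lemma is_diff_comp1 (R : realFieldType) (V : normedModType R) (f df : V -> R)
    (h : R -> R) (x : V) : is_diff x f df ->
  derivable h (f x) 1 ->
  is_diff x (fun w => h (f w)) (fun v => df v * derive1 h (f x)).
Proof.
move=> dfx dh.
have dhx : is_diff (f x) h ( *:%R^~ (derive1 h (f x))).
  by apply: DiffDef; [exact/derivable1_diffP | exact: deriv1E].
exact: (@is_diff_comp _ _ _ _ f df h).
Qed.

Lemma is_diff_coord (R : realFieldType) m n (i : 'I_m.+1) (j : 'I_n.+1)
    (M : 'M[R]_(m.+1, n.+1)) :
  is_diff M (fun N : 'M[R]_(m.+1, n.+1) => N i j : R)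
            (fun N : 'M[R]_(m.+1, n.+1) => N i j).
Proof.
(* Packaged as a linear map, the coordinate is continuous and hence its own differential. *)
have @f : {linear 'M[R]_(m.+1, n.+1) -> R}.
  by exists (fun N : 'M[R]_(_, _) => N i j); do 2![eexists]; do ?[constructor];
     rewrite ?mxE// => ? *; rewrite ?mxE//; move=> ?; rewrite !mxE.
apply: DiffDef; first exact: differentiable_coord.
exact: (@diff_lin _ _ _ f M (@coord_continuous _ _ _ _ _)).
Qed.

(** A row is the sum of its entries times the basis rows, so the claim reduces to sums and to scalar
    functions composed with a linear map. *)
Lemma is_diff_row (R : realFieldType) (V : normedModType R) n
    (f df : 'I_n.+1 -> V -> R) (x : V) :
  (forall j, is_diff x (f j) (df j)) ->
  is_diff x (fun w => \row_j f j w) (fun v => \row_j df j v).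
Proof.
move=> dfx.
have rowE (h : 'I_n.+1 -> V -> R) :
    (fun w => \row_j h j w) = \sum_(j < n.+1) (fun w => h j w *: delta_mx 0 j).
  by apply/funext => w; rewrite fct_sumE [LHS]row_sum_delta;
    apply: eq_bigr => j _; rewrite mxE.
have dterm j : is_diff x (fun w => f j w *: (delta_mx 0 j : 'rV[R]_n.+1))
                         (fun v => df j v *: (delta_mx 0 j : 'rV[R]_n.+1)).
  exact: (@is_diff_comp _ _ _ _ (f j) (df j) ( *:%R^~ _)).
rewrite !rowE; elim/big_ind2 : _ => //; last by move=> *; exact: is_diffD.
exact: is_diff_cst.
Qed.

Lemma jacobian_is_diff (R : realFieldType) m n (F : 'rV[R]_m.+1 -> 'rV[R]_n.+1)
    (A : 'M[R]_(m.+1, n.+1)) p :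
  is_diff p F (fun v => v *m A) -> jacobian F p = A.
Proof.
by move=> dF; apply/row_matrixP => i; rewrite !rowE mul_rV_lin1 diff_val.
Qed.

Lemma is_derive_row_coord (R : realFieldType) n (g : R -> 'rV[R]_n) (t : R)
    (dg : 'rV[R]_n) j :
  is_derive t 1 g dg -> is_derive t 1 (fun s => g s 0 j) (dg 0 j).
Proof.
move=> [gd gE]; apply: DeriveDef; first by have /derivable_mxP/(_ 0 j) := gd.
by rewrite -gE derive_mx// mxE.
Qed.

(** This serves the time reversal that carries results at [-oo] over to [+oo]. *)
Lemma is_derive_compN (R : realFieldType) (V : normedModType R) (f : R -> V)
    (df : V) (t : R) :
  is_derive (- t) 1 f df -> is_derive t 1 (fun s => f (- s)) (- df).
Proof.
move=> fd.
have dfd : is_diff (- t) f (fun h => h *: df).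
  apply: DiffDef; first exact/derivable1_diffP/ex_derive.
  by rewrite deriv1E ?derive1E ?derive_val.
have dN : is_diff t (-%R : R -> R) -%R by exact: is_diffN.
have dc := @is_diff_comp _ _ _ _ _ _ f _ t dN dfd.
apply: DeriveDef; first exact/diff_derivable/ex_diff.
by rewrite deriveE ?diff_val //= scaleN1r.
Qed.

(** * Convergence and blow-up criteria for real functions *)

(* Since [D' >= k D = k L'] near [-oo], the function [L - D / k] is nonincreasing
   there, which bounds the nondecreasing function [L] from below. *)
Lemma cvgNy_dominated_rate (R : realType) (T k : R) (L D c : R -> R) :
  0 < k ->
  (forall t, t < T -> 0 < D t) ->
  (forall t, t < T -> is_derive t 1 L (D t)) ->
  (forall t, t < T -> is_derive t 1 D (c t * D t)) ->
  (\forall t \near -oo, k <= c t) ->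
  exists l : R, L t @[t --> -oo] --> l.
Proof.
move=> k0 D0 dL dD [M [_ kc]].
(* Subtracting 1 puts [N] strictly below both [M] and [T], so all bounds hold on the closed
   half-line up to [N]. *)
pose N := Num.min M T - 1.
have NM : N < M by rewrite ltrBlDr (@le_lt_trans _ _ M) ?ge_min ?lexx ?ltrDl.
have NT : N < T by rewrite ltrBlDr (@le_lt_trans _ _ T) ?ge_min ?lexx ?orbT ?ltrDl.
pose h t := L t - k^-1 * D t.
have dh t : t < T -> is_derive t 1 h (D t - k^-1 * (c t * D t)).
  move=> tT; have := dL t tT; have := dD t tT => dDt dLt.
  exact: (@is_deriveB _ _ _ L (k^-1 \*: D)).
have Nincr s : s <= N -> s < T by move=> /le_lt_trans; exact.
have itvNT s : s \in `]-oo, N[%R -> s < T.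
  by rewrite in_itv/= => /ltW/Nincr.
have hN t : t <= N -> h N <= h t.
  move=> tN; apply: (@ler0_derive1_nincrNy _ h N) => //.
  - by move=> s /itvNT sT; have := dh s sT => ?; exact: ex_derive.
  - move=> s sN; have sT := itvNT _ sN; have dhs := dh s sT.
    rewrite derive1E derive_val subr_le0 -ler_pdivrMl ?invr_gt0 ?invrK//.
    rewrite ler_wpM2r ?(ltW (D0 _ _))//; apply: kc.
    by move: sN; rewrite in_itv/= => /lt_trans; exact.
  - apply: derivable_within_continuous => s; rewrite in_itv/= => /Nincr sT.
    by have := dh s sT => ?; exact: ex_derive.
have Lmono s t : s <= t -> t <= N -> L s <= L t.
  move=> st tN; apply: (@ger0_derive1_ndecrNy _ L N) => //.
  - by move=> r /itvNT rT; have := dL r rT => ?; exact: ex_derive.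
  - move=> r /itvNT rT; have dLr := dL r rT.
    by rewrite derive1E derive_val ltW ?D0.
  - apply: derivable_within_continuous => r; rewrite in_itv/= => /Nincr rT.
    by have := dL r rT => ?; exact: ex_derive.
have Llow t : t <= N -> h N <= L t.
  move=> tN; rewrite (le_trans (hN t tN))// gerBl mulr_ge0 ?invr_ge0 ?(ltW k0)//.
  exact/ltW/D0/Nincr.
(* Reflecting time and freezing [L] beyond [N] gives a function nondecreasing on the whole line, to
   which monotone convergence at [+oo] applies. *)
pose f s := - L (Num.min (- s) N).
have fcv : f s @[s --> +oo] --> sup (range f).
  apply: nondecreasing_cvgr.
    move=> s t st; rewrite lerN2; apply: Lmono; last by rewrite ge_min lexx orbT.
    by apply: le_min2; rewrite ?lerN2.
  by exists (- h N) => _ [s _ <-]; rewrite lerN2 Llow// ge_min lexx orbT.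
exists (- sup (range f)); apply/cvgNy_compNP.
move/cvgN : fcv; apply: cvg_trans; apply: near_eq_cvg.
near=> s; rewrite /= /f opprK min_l// lerNl.
by near: s; apply: nbhs_pinfty_ge; rewrite num_real.
Unshelve. all: by end_near. Qed.

(** Time reversal reduces this to [-oo]: [- L (- t)] has derivative [D (- t)], while the logarithmic
    rate of [D (- t)] is [- c (- t)]. *)
Lemma cvgy_dominated_rate (R : realType) (T k : R) (L D c : R -> R) :
  0 < k ->
  (forall t, T < t -> 0 < D t) ->
  (forall t, T < t -> is_derive t 1 L (D t)) ->
  (forall t, T < t -> is_derive t 1 D (c t * D t)) ->
  (\forall t \near +oo, c t <= - k) ->
  exists l : R, L t @[t --> +oo] --> l.
Proof.
move=> k0 D0 dL dD kc.
have ltN t : t < - T -> T < - t by rewrite ltrNr.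
have [| | | |l Ll] := @cvgNy_dominated_rate R (- T) k (fun t => - L (- t))
    (fun t => D (- t)) (fun t => - c (- t)) k0.
- by move=> t /ltN/D0.
- move=> t /ltN/dL/is_derive_compN dLN; rewrite -[D (- t)]opprK.
  exact: (@is_deriveN _ _ _ (fun s => L (- s))).
- by move=> t /ltN/dD/is_derive_compN; rewrite mulNr.
- by move: kc; rewrite -ninftyN => kcN; near=> t; rewrite lerNr; near: t; exact: kcN.
exists (- l); apply/cvgy_compNP; move/cvgN : Ll.
by apply: cvg_trans; apply: near_eq_cvg; near=> t; rewrite /= opprK.
Unshelve. all: by end_near. Qed.

(** Eventually [|b|] exceeds [|l| / 2]. Positivity of [D] sends its inverse to [+oo] and excludes
    the default value [0^-1 = 0]. *)
Lemma cvg_norm_divr0 (R : realFieldType) (T : Type) (F : set_system T)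
    (FF : Filter F) (D b : T -> R) (l : R) :
  l != 0 -> (\forall t \near F, 0 < D t) ->
  D t @[t --> F] --> 0 -> b t @[t --> F] --> l ->
  `|(D t)^-1 * b t| @[t --> F] --> +oo.
Proof.
move=> l0 D0 Dc bc.
have Dy : (D t)^-1 @[t --> F] --> +oo by apply/cvgrVy.
have bn : \forall t \near F, `|l| / 2 <= `|b t|.
  apply: (@cvgr_norm_ge _ _ _ _ _ _ _ bc).
  by rewrite gtr_pMr ?normr_gt0// invf_lt1// ltr1n.
apply/cvgryPge => A.
near=> t.
have Dt : 0 < D t by near: t.
rewrite normrM gtr0_norm ?invr_gt0//.
have l20 : 0 < `|l| / 2 by rewrite divr_gt0 ?normr_gt0.
apply: (@le_trans _ _ ((D t)^-1 * (`|l| / 2))).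
  rewrite -ler_pdivrMr//; near: t; exact: (cvgryPge _).1.
rewrite ler_wpM2l ?invr_ge0 ?(ltW Dt)//; near: t; exact: bn.
Unshelve. all: by end_near. Qed.

(** * The critical point, its linearization and its eigenvalues *)

Section CriticalPoint.
Context {R : realType} (eps xi wm : R) (I : set R) (z : R -> R) (l1 : R).
Hypothesis smooth_z : smooth_on I z.
Hypothesis dz_neq0 : forall l, I l -> derive1 z l != 0.
Hypothesis coupling_gt0 : 0 < eps * xi * (1 - 6 * xi).
Hypothesis Il1 : I l1.
Hypothesis zl1 : z l1 ^+ 2 = 1 / (6 * eps * xi * (1 - 6 * xi)).

Let K := eps * xi * (1 - 6 * xi).
Let D := Dfun eps xi z.
Let B := Bfun eps xi wm z.
Let F := vfield eps xi wm z.
Let p := state (- 6 * xi * z l1) 0 l1.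

(** This is the form in which the value of [z l1 ^+ 2] enters all later identities. *)
Lemma coupling_sqr_z : eps * xi * (1 - 6 * xi) * z l1 ^+ 2 = 1 / 6.
Proof.
have K0 : K != 0 by rewrite gt_eqF.
rewrite zl1 (_ : 6 * eps * xi * (1 - 6 * xi) = 6 * K); last by rewrite /K; ring.
by rewrite -/K; field.
Qed.

Lemma xi_neq0 : xi != 0.
Proof. by apply: contraTneq coupling_gt0 => ->; rewrite mulr0 mul0r ltxx. Qed.

Lemma Dfun_critical : D l1 = 0.
Proof.
rewrite /D /Dfun.
rewrite (_ : _ * _ = 6 * (eps * xi * (1 - 6 * xi) * z l1 ^+ 2)); last by ring.
by rewrite coupling_sqr_z; field.
Qed.

Lemma Bfun_critical : B (- 6 * xi * z l1) 0 l1 = 4 * xi.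
Proof.
rewrite /B /Bfun.
(* Since [x + z = (1 - 6 xi) z] at the point, both quadratic terms contain the factor [K z^2]. *)
transitivity (- (4 / 3) + (eps * xi * (1 - 6 * xi) * z l1 ^+ 2) *
  (36 * xi * (1 - wm) + 2 * (1 - 3 * wm) * (1 - 6 * xi)) + (1 + wm)).
  by ring.
by rewrite coupling_sqr_z; field.
Qed.

Lemma z_derivable l : I l -> derivable z l 1.
Proof. by move=> Il; have := smooth_z (n := 0) Il; rewrite derive1n0. Qed.

Lemma dz_derivable l : I l -> derivable (derive1 z) l 1.
Proof. by move=> Il; have := smooth_z (n := 1) Il; rewrite derive1n1. Qed.

Lemma is_derive_Dfun l : I l ->
  is_derive l 1 D (- (12 * (eps * xi * (1 - 6 * xi)) * z l * derive1 z l)).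
Proof.
move=> /z_derivable dz.
have : is_diff l D
    (fun v => - (12 * (eps * xi * (1 - 6 * xi)) * z l * derive1 z l) * v).
  have dz' : is_diff l z (fun v => v * derive1 z l).
    by apply: (@is_diff_comp1 _ _ id id z) => //; exact: is_diff_id.
  rewrite /D /Dfun; apply: is_diff_eq; apply/funext => v /=; rewrite !fctE/=.
  rewrite /GRing.scale/= -[X in X - _]/(0 : R); ring.
move=> dD; apply: DeriveDef; first exact/diff_derivable/ex_diff.
by rewrite deriveE ?diff_val ?mulr1.
Qed.

Let x0 := - 6 * xi * z l1.

Lemma critical_x : p 0 0 = x0. Proof. by rewrite mxE. Qed.
Lemma critical_y : p 0 1 = 0. Proof. by rewrite mxE. Qed.
Lemma critical_l : p 0 2 = l1. Proof. by rewrite mxE. Qed.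

Lemma critical_point_vfield : critical_point F p.
Proof.
rewrite /critical_point /F /vfield critical_x critical_y critical_l.
apply/rowP => j; rewrite !mxE.
have := Dfun_critical; rewrite /D => D0.
case: j => [[|[|[|//]]] jlt] /=; rewrite /field_x /field_y /field_l D0 /x0; ring.
Qed.

(** Entry [(i, j)] is the derivative of component [j] in variable [i], matching the action on row
    vectors. The only off-diagonal entry is thus the derivative of [field_x] in the variable [l],
    and the matrix is lower triangular. *)
Definition critical_jacobian : 'M[R]_3 := \matrix_(i, j)
  if i == j then if i == 2 then 12 * xi else 6 * xi
  else if (i == 2) && (j == 0) then (36 * xi ^+ 2 - 12 * xi) * derive1 z l1
  else 0.

(** At [p] the factors [D], [x + 6 xi z] and [y] all vanish, so in each product rule the
    differential of the cofactor drops out. *)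
Lemma is_diff_vfield : is_diff p F (fun v => v *m critical_jacobian).
Proof.
have dz := z_derivable Il1; have ddz := dz_derivable Il1.
pose X (w : 'rV[R]_3) : R := w 0 0; pose Y (w : 'rV[R]_3) : R := w 0 1.
pose L (w : 'rV[R]_3) : R := w 0 2.
have dX : is_diff p X X by exact: is_diff_coord.
have dY : is_diff p Y Y by exact: is_diff_coord.
have dL : is_diff p L L by exact: is_diff_coord.
have Lp : L p = l1 by rewrite /L critical_l.
have dZ : is_diff p (fun w => z (L w)) (fun v => L v * derive1 z l1).
  by rewrite -Lp; apply: is_diff_comp1; rewrite ?Lp.
have dW : is_diff p (fun w => (derive1 z (L w))^-1)
  (fun v => L v * derive1 (fun l => (derive1 z l)^-1) l1).
  rewrite -Lp; apply: (is_diff_comp1 (h := fun l => (derive1 z l)^-1)) => //.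
  by rewrite Lp; apply: derivableV => //; exact: dz_neq0.
have dD : is_diff p (fun w => D (L w))
  (fun v => L v * - (12 * (eps * xi * (1 - 6 * xi)) * z l1 * derive1 z l1)).
  have dDl := is_derive_Dfun Il1.
  have <- : derive1 D l1 = - (12 * (eps * xi * (1 - 6 * xi)) * z l1 * derive1 z l1).
    by rewrite derive1E derive_val.
  rewrite -Lp.
  by apply: is_diff_comp1; rewrite ?Lp; exact: ex_derive.
(* The value of [dB] can stay abstract: it gets multiplied by [x + 6 xi z] or by [y], both zero at
   [p]. *)
have [dB dBE] : exists dB, is_diff p (fun w => B (X w) (Y w) (L w)) dB.
  by eexists; rewrite /B /Bfun; apply: is_diff_eq.
pose f (j : 'I_3) (w : 'rV[R]_3) := [:: field_x eps xi wm z (X w) (Y w) (L w);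
   field_y eps xi wm z (X w) (Y w) (L w); field_l eps xi z (X w) (Y w) (L w)]`_j.
have -> : F = fun w => \row_j f j w by [].
have -> : (fun v => v *m critical_jacobian) =
    fun v => \row_j (v *m critical_jacobian) 0 j.
  by apply/funext => v; apply/rowP => j; rewrite [RHS]mxE.
apply: is_diff_row => j.
have Xp : X p = x0 by rewrite /X critical_x.
have Yp : Y p = 0 by rewrite /Y critical_y.
have D0 := Dfun_critical; have B0 := Bfun_critical.
have dJ v : (v *m critical_jacobian) 0 j = X v * critical_jacobian 0 j +
    Y v * critical_jacobian 1 j + L v * critical_jacobian 2 j.
  rewrite mxE !big_ord_recl big_ord0 addr0 addrA.
  have -> : lift ord0 (lift ord0 ord0) = 2 :> 'I_3 by apply/val_inj.
  by have -> : lift ord0 ord0 = 1 :> 'I_3 by apply/val_inj.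
case: j dJ => [[|[|[|//]]] jlt] dJ; rewrite /f /=.
- rewrite /field_x -/D -/B; apply: is_diff_eq; apply/funext => v /=.
  rewrite dJ !mxE !fctE /GRing.scale/= Xp Yp Lp D0 B0 /x0; apply/subr0_eq.
  (* The two sides agree only modulo [coupling_sqr_z]: their difference is a multiple of
     [K z^2 - 1/6]. *)
  transitivity ((eps * xi * (1 - 6 * xi) * z l1 ^+ 2 - 1 / 6) *
    (- 72 * xi * derive1 z l1 * L v)); first by field.
  by rewrite coupling_sqr_z subrr mul0r.
- rewrite /field_y -/D -/B; apply: is_diff_eq; apply/funext => v /=.
  by rewrite dJ !mxE !fctE /GRing.scale/= Xp Yp Lp D0 B0; field.
- rewrite /field_l -/D; apply: is_diff_eq; apply/funext => v /=.
  rewrite dJ !mxE !fctE /GRing.scale/= Xp Lp D0 /x0; apply/subr0_eq.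
  transitivity ((eps * xi * (1 - 6 * xi) * z l1 ^+ 2 - 1 / 6) *
    (72 * xi * L v)); first by field; exact: dz_neq0.
  by rewrite coupling_sqr_z subrr mul0r.
Qed.

Lemma jacobian_vfield : jacobian F p = critical_jacobian.
Proof. exact/jacobian_is_diff/is_diff_vfield. Qed.

Lemma char_poly_critical_jacobian : char_poly critical_jacobian =
  ('X - (6 * xi)%:P) * ('X - (6 * xi)%:P) * ('X - (12 * xi)%:P).
Proof.
rewrite char_poly_trig; first by rewrite !big_ord_recl big_ord0 mulr1 mulrA !mxE.
apply/is_trig_mxP => i j; rewrite mxE.
by case: i => [[|[|[|//]]] ilt]; case: j => [[|[|[|//]]] jlt].
Qed.

Lemma vfield_eigenvalue mu : linearization_eigenvalue F p mu ->
  mu = real_complex R (6 * xi) \/ mu = real_complex R (12 * xi).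
Proof.
rewrite /linearization_eigenvalue jacobian_vfield eigenvalue_root_char.
rewrite -map_char_poly char_poly_critical_jacobian 2!rmorphM 2!rmorphB/=.
rewrite !map_polyX !map_polyC/=.
by rewrite !rootM !root_XsubC -orbA orbA orbb => /orP[] /eqP; [left|right].
Qed.

Lemma vfield_unstable : 0 < xi -> unstable_node F p.
Proof.
move=> xi0; split; first exact: critical_point_vfield.
  by have := is_diff_vfield => ?; exact: ex_diff.
by move=> mu /vfield_eigenvalue[] ->; [exists (6 * xi)|exists (12 * xi)] => //;
  rewrite mulr_gt0.
Qed.

Lemma vfield_stable : xi < 0 -> stable_node F p.
Proof.
move=> xi0; split; first exact: critical_point_vfield.
  by have := is_diff_vfield => ?; exact: ex_diff.
by move=> mu /vfield_eigenvalue[] ->; [exists (6 * xi)|exists (12 * xi)] => //;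
  rewrite pmulr_rlt0.
Qed.

(** This is the logarithmic derivative of [D] along the flow; the [z'] from the chain rule cancels
    the denominator of [field_l]. *)
Definition Dfun_log_deriv (v : 'rV[R]_3) : R :=
  - (12 * (eps * xi * (1 - 6 * xi)) * z (v 0 2) * v 0 0).

Lemma is_derive_Dfun_trajectory (J : set R) g t :
  physical_trajectory eps xi wm z I J g -> J t ->
  is_derive t 1 (fun s => D (g s 0 2)) (Dfun_log_deriv (g t) * D (g t 0 2)).
Proof.
move=> phys /phys[Igt _ /is_derive_row_coord dg].
have dl := dg 2; have dD := is_derive_Dfun Igt.
apply: (is_derive_eq (is_derive1_comp dD dl)).
by rewrite mxE/= /field_l /Dfun_log_deriv -/D; field; exact: dz_neq0.
Qed.

(** * Limits at the critical point, along an arbitrary filter so as to cover both time directions *)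

Section Limits.
Context (G : set_system R) {FG : Filter G} (g : R -> 'rV[R]_3).
Hypothesis gp : g t @[t --> G] --> p.

Let cvg_coord j : g t 0 j @[t --> G] --> p 0 j.
Proof. exact: (cvg_comp _ _ gp (@coord_continuous _ _ _ 0 j p)). Qed.

Let cvg_x : g t 0 0 @[t --> G] --> x0.
Proof. by rewrite -critical_x. Qed.

Let cvg_y : g t 0 1 @[t --> G] --> (0 : R).
Proof. by rewrite -critical_y. Qed.

Let cvg_l : g t 0 2 @[t --> G] --> l1.
Proof. by rewrite -critical_l. Qed.

Let cvg_z : z (g t 0 2) @[t --> G] --> z l1.
Proof.
have zc : {for l1, continuous z}.
  exact/differentiable_continuous/derivable1_diffP/z_derivable.
exact: (cvg_comp _ _ cvg_l zc).
Qed.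

Lemma cvg_Dfun : D (g t 0 2) @[t --> G] --> 0.
Proof.
rewrite -Dfun_critical; apply: cvgB; first exact: cvg_cst.
by apply: cvgM; [exact: cvg_cst|exact: (cvgM cvg_z cvg_z)].
Qed.

Lemma cvg_Dfun_log_deriv : Dfun_log_deriv (g t) @[t --> G] --> 12 * xi.
Proof.
have -> : 12 * xi = - (12 * (eps * xi * (1 - 6 * xi)) * z l1 * x0).
  transitivity (72 * xi * (eps * xi * (1 - 6 * xi) * z l1 ^+ 2)).
    by rewrite coupling_sqr_z; field.
  by rewrite /x0; ring.
by apply: cvgN; apply: cvgM => //; apply: cvgM => //; exact: cvg_cst.
Qed.

Lemma cvg_weff : (\forall t \near G, 0 < D (g t 0 2)) ->
  `|weff eps xi wm z (g t)| @[t --> G] --> +oo.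
Proof.
move=> D0; apply: (@cvg_norm_divr0 _ _ _ _ _ _ (4 * xi)) => //; last first.
(* The numerator of [weff] exceeds [B] by [1/3 - 2 K z^2], which vanishes at the critical point. *)
- have -> : 4 * xi = - 1 + eps * (1 - 6 * xi) * (1 - wm) * x0 ^+ 2
   + 2 * eps * xi * (1 - 3 * wm) * (x0 + z l1) ^+ 2
   + (1 + wm) * (1 - 0 ^+ 2)
   - 2 * eps * xi * (1 - 6 * xi) * z l1 ^+ 2
   - 2 * xi * 0 ^+ 2 * l1 * z l1.
    rewrite -Bfun_critical /B /Bfun /x0; apply/subr0_eq.
    transitivity (2 * (eps * xi * (1 - 6 * xi) * z l1 ^+ 2) - 1 / 3); first by field.
    by rewrite coupling_sqr_z; field.
  by repeat first [exact: cvg_cst | exact: cvg_x | exact: cvg_y | exact: cvg_l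
     | exact: cvg_z | apply: cvgD | apply: cvgN | apply: cvgM | rewrite !expr2].
- exact: cvg_Dfun.
- by rewrite mulf_neq0 ?xi_neq0.
Qed.

End Limits.

(** * Past and future singularities *)

Lemma past_singularity_critical : 0 < xi -> past_singularity eps xi wm z I p.
Proof.
move=> xi0 T g a phys scale gp.
have nearT : \forall t \near -oo, t < T by apply: nbhs_ninfty_lt; rewrite num_real.
split; last first.
  apply: (cvg_weff gp); near=> t; have [|_ //] := phys t; rewrite ?in_itv//=.
  by near: t.
(* The rate [6 xi] is half the limit [12 xi] of the logarithmic derivative, hence eventually a lower
   bound for it. *)
apply: (@cvgNy_dominated_rate _ T (6 * xi) _ (fun t => D (g t 0 2))
  (fun t => Dfun_log_deriv (g t))); first by rewrite mulr_gt0.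
- by move=> t tT; have [|_ //] := phys t; rewrite /= in_itv.
- by move=> t tT; have [|_ //] := scale t; rewrite /= in_itv.
- by move=> t tT; apply: (is_derive_Dfun_trajectory phys); rewrite /= in_itv.
- apply: (cvgr_ge _ (cvg_Dfun_log_deriv gp)).
  by rewrite ltr_pM2r// ltr_nat.
Unshelve. all: by end_near. Qed.

Lemma future_singularity_critical : xi < 0 -> future_singularity eps xi wm z I p.
Proof.
move=> xi0 T g a phys scale gp.
have nearT : \forall t \near +oo, T < t by apply: nbhs_pinfty_gt; rewrite num_real.
split; last first.
  apply: (cvg_weff gp); near=> t; have [|_ //] := phys t.
  by rewrite /= in_itv/= andbT; near: t.
apply: (@cvgy_dominated_rate _ T (- (6 * xi)) _ (fun t => D (g t 0 2))
  (fun t => Dfun_log_deriv (g t))); first by rewrite oppr_gt0 pmulr_rlt0.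
- by move=> t tT; have [|_ //] := phys t; rewrite /= in_itv/= andbT.
- by move=> t tT; have [|_ //] := scale t; rewrite /= in_itv/= andbT.
- by move=> t tT; apply: (is_derive_Dfun_trajectory phys); rewrite /= in_itv/= andbT.
- apply: (cvgr_le _ (cvg_Dfun_log_deriv gp)).
  by rewrite opprK ltr_nM2r// ltr_nat.
Unshelve. all: by end_near. Qed.

End CriticalPoint.

Theorem mainTheorem1 (R : realType) (eps xi wm : R) (I : set R) (z : R -> R)
    (l1 : R)
    (Heps : eps = 1 \/ eps = -1)
    (HI : open_interval I)
    (Hz : smooth_on I z)
    (Hz' : forall l, I l -> derive1 z l != 0)
    (Hpos : 0 < eps * xi * (1 - 6 * xi))
    (Hl1 : I l1)
    (Hzl1 : z l1 ^+ 2 = 1 / (6 * eps * xi * (1 - 6 * xi))) :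
  let F := vfield eps xi wm z in
  let p := state (- 6 * xi * z l1) 0 l1 in
  ([/\ critical_point F p,
       differentiable F p,
       char_poly (jacobian F p) =
         ('X - (6 * xi)%:P) * ('X - (6 * xi)%:P) * ('X - (12 * xi)%:P),
       0 < xi -> unstable_node F p &
       xi < 0 -> stable_node F p /\ eps = -1])
  /\
  ([/\ 0 < xi -> past_singularity eps xi wm z I p,
       xi < 0 -> future_singularity eps xi wm z I p,
       eps = 1 /\ 0 < xi < 1 / 6 \/ eps = -1 /\ 1 / 6 < xi ->
         unstable_node F p /\ past_singularity eps xi wm z I p &
       eps = -1 /\ xi < 0 ->
         stable_node F p /\ future_singularity eps xi wm z I p]).
Proof.
have past_sing := past_singularity_critical (wm := wm) Hz Hz' Hpos Hl1 Hzl1.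
have future_sing := future_singularity_critical (wm := wm) Hz Hz' Hpos Hl1 Hzl1.
have unst := vfield_unstable wm Hz Hz' Hpos Hl1 Hzl1.
have st := vfield_stable wm Hz Hz' Hpos Hl1 Hzl1.
have dF := is_diff_vfield wm Hz Hz' Hpos Hl1 Hzl1.
move=> F p; split; split => //.
- exact: critical_point_vfield.
- rewrite /F /p (jacobian_vfield wm Hz Hz' Hpos Hl1 Hzl1).
  exact: char_poly_critical_jacobian.
- move=> xi0; split; first exact: st.
  (* For [eps = 1], [xi < 0] makes [1 - 6 xi] positive, so the coupling hypothesis would force
     [xi > 0]. *)
  case: Heps => // eps1; move: Hpos; rewrite eps1 mul1r pmulr_lgt0.
    by rewrite ltNge (ltW xi0).
  by rewrite subr_gt0 (lt_trans _ ltr01)// pmulr_rlt0.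
- case=> [[_ /andP[xi0 _]]|[_ xi16]]; first by split; [exact: unst|exact: past_sing].
  have xi0 : 0 < xi by apply: lt_trans xi16; rewrite divr_gt0.
  by split; [exact: unst|exact: past_sing].
- by case=> _ xi0; split; [exact: st|exact: future_sing].
Qed.
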